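(* Let $\gamma$ be a proper triharmonic (i.e. proper $3$-harmonic) $2$-Frenet curve in a semi-Riemannian space form $N^m_t(c)$, $m\ge2$, $1\le t\le m-1$. Then necessarily $\epsilon_2\,c>0$, where $\epsilon_2=\langle N,N\rangle$ and $N=F_2$ is the normal vector field, and the curvature of $\gamma$ is a constant given by $$\kappa=\sqrt{2\,\epsilon_2\,c}.$$
   Context: Conventions. For a semi-Riemannian manifold $(M,\langle\,,\rangle)$ with Levi-Civita connection $\nabla$, $R(X,Y)Z=\nabla_X\nabla_YZ-\nabla_Y\nabla_XZ-\nabla_{[X,Y]}Z$. Curves $\gamma:I\to M$ ($I$ an open real interval) are smooth, nonnull, parametrized by arc length; $T=\gamma'$, $\langle T,T\rangle=\epsilon_1\in\{1,-1\}$. Put $\nabla_T^0T=T$, $\nabla_T^jT=\nabla_T(\nabla_T^{j-1}T)$. A curve is triharmonic if $$\tau_3(\gamma)=\nabla^{5}_T T+R\big(\nabla^{3}_T T,T\big)T-R\big(\nabla^{2}_T T,\nabla_T T\big)T=0,$$ and proper triharmonic if it is triharmonic and not a geodesic. A $2$-Frenet curve is a curve admitting a frame $\{F_1=T,F_2=N\}$ along it with $\langle F_i,F_i\rangle=\epsilon_i=\pm1$, $\langle F_1,F_2\rangle=0$, and $\nabla_TT=\epsilon_2kN$, $\nabla_TN=-\epsilon_1kT$, where the curvature $k(s)$ is a positive smooth function. Space forms: let $\mathbb{R}^n_t$ be $\mathbb{R}^n$ with $\langle x,y\rangle=-\sum_{i=1}^t x_iy_i+\sum_{i=t+1}^n x_iy_i$.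 $N^m_t(c)$ denotes $\mathbb{R}^m_t$ if $c=0$, $\{x\in\mathbb{R}^{m+1}_t:\langle x,x\rangle=1/c\}$ if $c>0$, $\{x\in\mathbb{R}^{m+1}_{t+1}:\langle x,x\rangle=1/c\}$ if $c<0$, with the induced metric of index $t$; its curvature is $R(X,Y)Z=c(\langle Y,Z\rangle X-\langle X,Z\rangle Y)$. *)

(* Defs.v *)
From HB Require Import structures.
From mathcomp Require Export all_boot all_order all_algebra.
From mathcomp Require Export all_classical all_reals all_analysis.

Set Implicit Arguments.
Unset Strict Implicit.
Unset Printing Implicit Defensive.

Export Order.TTheory GRing.Theory Num.Theory.
Export numFieldNormedType.Exports.

Local Open Scope classical_set_scope.
Local Open Scope ring_scope.

Section Curves.
Context {R : realType}.

(* A curve on an open interval I is represented by a total function on R;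
   only its values on I matter, since derivatives at points of the open set I
   are local.  Below, every condition is imposed on I only. *)
Definition open_interval (I : set R) : Prop :=
  [/\ open I, is_interval I & I !=set0].

Definition smooth_on (V : normedModType R) (I : set R) (f : R -> V) : Prop :=
  forall (j : nat) (s : R), I s -> derivable (derive1n j f) s 1.

Definition is_sign (e : R) : Prop := e = 1 \/ e = -1.

(* The inner product of R^n_p: the first p coordinates are the timelike ones. *)
Definition sprod (n p : nat) (x y : 'rV[R]_n) : R :=
  - (\sum_(i < n | (i < p)%N) x 0 i * y 0 i)
  + \sum_(i < n | (p <= i)%N) x 0 i * y 0 i.

(* N^m_t(c) sits in R^m_t if c = 0, in R^(m+1)_t if c > 0 and in R^(m+1)_(t+1)
   if c < 0. *)
Definition ambient_dim (m : nat) (c : R) : nat := if c == 0 then m else m.+1.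
Definition ambient_index (t : nat) (c : R) : nat := if c < 0 then t.+1 else t.

Section SpaceForm.
Variables (m t : nat) (c : R).

Local Notation E := 'rV[R]_(ambient_dim m c).

Definition metric (x y : E) : R := sprod (ambient_index t c) x y.

Definition space_form : set E :=
  [set x | c = 0 \/ metric x x = c^-1].

(* For c <> 0, the tangent space at p is the kernel of the differential
   of x |-> metric x x, and p itself spans the normal line. *)
Definition tangent_space (p : E) : set E :=
  [set v | c = 0 \/ metric v p = 0].

Definition tangent_proj (p v : E) : E :=
  if c == 0 then v else v - (metric v p / metric p p) *: p.

Lemma metricC (x y : E) : metric x y = metric y x.
Proof.
by rewrite /metric /sprod; congr (- _ + _); apply: eq_bigr => i _; rewrite mulrC.
Qed.

Lemma metricDl (x y z : E) : metric (x + y) z = metric x z + metric y z.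
Proof.
rewrite /metric /sprod addrACA -opprD -!big_split /=.
by congr (- _ + _); apply: eq_bigr => i _; rewrite mxE mulrDl.
Qed.

Lemma metricZl (a : R) (x z : E) : metric (a *: x) z = a * metric x z.
Proof.
rewrite /metric /sprod mulrDr mulrN !mulr_sumr.
by congr (- _ + _); apply: eq_bigr => i _; rewrite mxE mulrA.
Qed.

Lemma metricBl (x y z : E) : metric (x - y) z = metric x z - metric y z.
Proof. by rewrite metricDl -scaleN1r metricZl mulN1r. Qed.

Lemma tangent_projP (p v : E) :
  space_form p -> tangent_space p (tangent_proj p v).
Proof.
rewrite /tangent_space /tangent_proj /=; have [-> _|c0] := eqVneq c 0; first by left.
case=> [c00|pp]; first by rewrite c00 eqxx in c0.
by right; rewrite metricBl metricZl divfK ?subrr// pp invr_neq0.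
Qed.

Lemma normal_projP (p v w : E) :
  tangent_space p w -> metric (v - tangent_proj p v) w = 0.
Proof.
rewrite /tangent_space /tangent_proj /=; have [_ _|c0] := eqVneq c 0.
  by rewrite metricBl subrr.
case=> [c00|wp]; first by rewrite c00 eqxx in c0.
by rewrite subKr metricZl [metric p w]metricC wp mulr0.
Qed.

(* The covariant derivative along g of a vector field V along g, for the
   Levi-Civita connection of the induced metric: the tangential part of the
   ambient derivative (see tangent_projP, normal_projP and metric_covD). *)
Definition covD (g V : R -> E) : R -> E :=
  fun s => tangent_proj (g s) (derive1 V s).

Lemma metric_covD (g V W : R -> E) (s : R) :
  tangent_space (g s) (V s) -> tangent_space (g s) (W s) ->
  derivable V s 1 -> derivable W s 1 ->
  derive1 (fun r => metric (V r) (W r)) s =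
  metric (covD g V s) (W s) + metric (V s) (covD g W s).
Proof.
move=> tV tW dV dW.
have /eqP := normal_projP (derive1 V s) tW.
rewrite metricBl subr_eq0 => /eqP <-.
have /eqP := normal_projP (derive1 W s) tV.
rewrite metricBl subr_eq0 [in X in _ + X]metricC => /eqP <-.
have dVi i : derivable (fun r => V r 0 i) s 1 by exact: (derivable_mxP V s 1).1.
have dWi i : derivable (fun r => W r 0 i) s 1 by exact: (derivable_mxP W s 1).1.
have D (P : pred 'I_(ambient_dim m c)) :
    is_derive s (1 : R) (fun r => \sum_(i | P i) V r 0 i * W r 0 i)
      (\sum_(i | P i) (derive1 V s 0 i * W s 0 i + derive1 W s 0 i * V s 0 i)).
  have -> : (fun r => \sum_(i | P i) V r 0 i * W r 0 i) =
            \sum_(i | P i) ((fun r => V r 0 i) * (fun r => W r 0 i)).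
    by apply/funext => r; rewrite fct_sumE.
  elim/big_ind2: _ => [|f df h dh|i _]; [exact: is_derive_cst|exact: is_deriveD|].
  rewrite !derive1E !derive_mx// !mxE.
  apply: is_derive_eq; first by apply: is_deriveM; exact/derivableP.
  by rewrite addrC mulrC [X in _ + X]mulrC.
rewrite derive1E.
have := is_deriveD (is_deriveN (D (fun i => (i < ambient_index t c)%N)))
                   (D (fun i => (ambient_index t c <= i)%N)).
move=> /(@derive_val _ _ _ _ _ _ _) H; rewrite [LHS]H.
rewrite /metric /sprod addrACA -opprD -!big_split /=.
by congr (- _ + _); apply: eq_bigr => i _; rewrite [X in _ + X]mulrC.
Qed.

(* R(X, Y)Z = nabla_X nabla_Y Z - nabla_Y nabla_X Z - nabla_[X,Y] Z in constant
   curvature c. *)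
Definition curvature_tensor (X Y Z : E) : E :=
  c *: (metric Y Z *: X - metric X Z *: Y).

Definition velocity (g : R -> E) : R -> E := derive1 g.

Definition covDn_velocity (j : nat) (g : R -> E) : R -> E :=
  iter j (covD g) (velocity g).

Definition tau3 (g : R -> E) (s : R) : E :=
  let T j := covDn_velocity j g s in
  T 5%N + curvature_tensor (T 3%N) (T 0%N) (T 0%N)
  - curvature_tensor (T 2%N) (T 1%N) (T 0%N).

Definition unit_speed_curve (I : set R) (g : R -> E) (e1 : R) : Prop :=
  [/\ open_interval I, smooth_on I g, forall s, I s -> space_form (g s),
      is_sign e1 & forall s, I s -> metric (velocity g s) (velocity g s) = e1].

Definition geodesic (I : set R) (g : R -> E) : Prop :=
  forall s, I s -> covDn_velocity 1 g s = 0.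

Definition triharmonic (I : set R) (g : R -> E) : Prop :=
  forall s, I s -> tau3 g s = 0.

Definition proper_triharmonic (I : set R) (g : R -> E) : Prop :=
  triharmonic I g /\ ~ geodesic I g.

Definition tangent_field (I : set R) (g V : R -> E) : Prop :=
  smooth_on I V /\ forall s, I s -> tangent_space (g s) (V s).

(* The curve g, of causal character e1, is 2-Frenet with normal N of causal
   character e2 and curvature k. *)
Definition frenet2_curve (I : set R) (g : R -> E) (e1 e2 : R)
    (N : R -> E) (k : R -> R) : Prop :=
  [/\ unit_speed_curve I g e1,
      tangent_field I g N,
      is_sign e2,
      smooth_on I k &
      forall s, I s ->
      [/\ 0 < k s,
          metric (N s) (N s) = e2,
          metric (velocity g s) (N s) = 0,
          covD g (velocity g) s = (e2 * k s) *: N s &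
          covD g N s = - (e1 * k s) *: velocity g s]].

End SpaceForm.
End Curves.

(* Main.v *)
(* Expanding nabla_T^j T in the frame (T, N), the equation tau_3 = 0 splits, with
   e = e1 e2, into
     (tangential)  k k''' + 2 k' k'' - 2 e k^3 k' = 0,
     (normal)      k'''' - 15 e k k'^2 - 10 e k^2 k'' + k^5
                     + c e1 k'' - 2 e2 c k^3 = 0.
   The tangential equation has two first integrals,
     C1 = k k'' + k'^2 / 2 - e k^4 / 2  and  C2 = k k'^2 - e k^5 / 5 - 2 C1 k,
   through which k k'^2 and k^2 k'' are polynomials in k.  Substituting in the
   normal equation multiplied by k^5 makes k a root of a polynomial of degree 10
   with leading coefficient -126/25.  By continuity k is constant, and the normal
   equation reduces to k^5 = 2 e2 c k^3. *)
Require Import Defs.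
From mathcomp Require Import ring lra.

Local Open Scope classical_set_scope.
Local Open Scope ring_scope.

(** * Constancy of the solutions of the scalar curvature equations *)

Section ScalarODE.
Context {R : realType}.
Implicit Types (I : set R) (f k : R -> R).

Lemma is_derive_derive1n {I k} (j : nat) {s : R} :
  smooth_on I k -> I s -> is_derive s (1 : R) (derive1n j k) (derive1n j.+1 k s).
Proof. by move=> sk Is; rewrite derive1nS derive1E; apply/derivableP/sk. Qed.

Lemma interval_mem {I} {a b x : R} :
  is_interval I -> I a -> I b -> x \in `[a, b] -> I x.
Proof.
move=> itvI Ia Ib; rewrite in_itv /= => xab.
exact: itvI Ia Ib _ xab.
Qed.

Lemma derivable_within_segment {I f} {a b : R} :
  is_interval I -> (forall s, I s -> derivable f s 1) -> I a -> I b ->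
  {within `[a, b], continuous f}.
Proof.
move=> itvI df Ia Ib; apply: derivable_within_continuous => x xab.
exact: (df _ (interval_mem itvI Ia Ib xab)).
Qed.

Lemma derive0_cst_on {I f} : is_interval I ->
  (forall s, I s -> is_derive s (1 : R) f 0) ->
  forall a b, I a -> I b -> f a = f b.
Proof.
move=> itvI df.
suff H : forall a b, I a -> I b -> a < b -> f a = f b.
  by move=> a b Ia Ib; case: (ltgtP a b) => [/H->|/H->|->].
move=> a b Ia Ib ab.
have df0 x : x \in `]a, b[ -> is_derive x (1 : R) f ((fun=> 0) x).
  by move=> /subset_itv_oo_cc xab; exact: (df _ (interval_mem itvI Ia Ib xab)).
have cf : {within `[a, b], continuous f}.
  by apply: (derivable_within_segment itvI _ Ia Ib) => s /df[].
have [x _ /eqP] := MVT ab df0 cf.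
by rewrite mul0r subr_eq0 => /eqP.
Qed.

(* By the intermediate value theorem a nonconstant f would take infinitely
   many values. *)
Lemma root_cst_on {I f} {p : {poly R}} : is_interval I ->
  (forall s, I s -> derivable f s 1) ->
  p != 0 -> (forall s, I s -> root p (f s)) ->
  forall a b, I a -> I b -> f a = f b.
Proof.
move=> itvI df p0 pf.
suff H : forall a b, I a -> I b -> a < b -> f a = f b.
  by move=> a b Ia Ib; case: (ltgtP a b) => [/H->|/H->|->].
move=> a b Ia Ib ab; apply/eqP/negP => /negP fab.
(* The values [f a + i h] with [i < size p] are distinct, lie between [f a] and [f b], and are taken
   by [f]. They are therefore [size p] roots of [p], one more than its degree allows. *)
pose h := (f b - f a) / (size p)%:R.
have n0 : (size p)%:R != 0 :> R by rewrite pnatr_eq0 size_poly_eq0.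
have h0 : h != 0 by rewrite mulf_neq0 ?invr_neq0// subr_eq0 eq_sym.
pose rs := [seq f a + i%:R * h | i <- iota 0 (size p)].
suff : (size rs < size p)%N by rewrite size_map size_iota ltnn.
apply: (max_poly_roots p0).
  apply/allP => _ /mapP[i + ->]; rewrite mem_iota add0n => /= ip.
  have [||x xab <-] := IVT (f := f) (v := f a + i%:R * h) (ltW ab).
  - exact: (derivable_within_segment itvI).
  - have pn : 0 < (size p)%:R :> R by rewrite ltr0n lt0n size_poly_eq0.
    have t0 : 0 <= i%:R / (size p)%:R :> R by rewrite divr_ge0.
    have t1 : i%:R / (size p)%:R <= 1 :> R.
      by rewrite ler_pdivrMr// mul1r ler_nat ltnW.
    rewrite /h mulrCA; set t := _ / _ in t0 t1 *.
    by rewrite minElt maxElt; case: ifP => fl; apply/andP; split; nra.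
  - exact: (pf _ (interval_mem itvI Ia Ib xab)).
rewrite map_inj_uniq ?iota_uniq// => i j /addrI /(mulIf h0) /eqP.
by rewrite eqr_nat => /eqP.
Qed.

Lemma derive1_eq_on {V : normedModType R} {I} {f1 f2 : R -> V} : open I ->
  (forall s, I s -> f1 s = f2 s) -> forall s, I s -> derive1 f1 s = derive1 f2 s.
Proof.
move=> oI f12 s Is; rewrite !derive1E; apply: near_eq_derive.
by apply: filterS (open_nbhs_nbhs (conj oI Is)) => r /f12.
Qed.

(** The family [k_] stands for the successive derivatives of the curvature; for a Frenet curve
    [e = e1 e2], [a = c e1] and [b = 2 e2 c]. *)
Lemma curvature_ode_cst {I} {k_ : nat -> R -> R} {e a b : R} :
  open I -> is_interval I ->
  (forall j s, I s -> is_derive s (1 : R) (k_ j) (k_ j.+1 s)) ->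
  (forall s, I s -> k_ 0 s != 0) ->
  is_sign e ->
  (forall s, I s ->
     k_ 0 s * k_ 3 s + 2 * k_ 1 s * k_ 2 s - 2 * e * k_ 0 s ^+ 3 * k_ 1 s = 0) ->
  (forall s, I s ->
     k_ 4 s - 15 * e * k_ 0 s * k_ 1 s ^+ 2 - 10 * e * k_ 0 s ^+ 2 * k_ 2 s
     + k_ 0 s ^+ 5 + a * k_ 2 s - b * k_ 0 s ^+ 3 = 0) ->
  forall s, I s -> k_ 0 s ^+ 2 = b.
Proof.
move=> oI itvI dk k0 he tangential normal s0 Is0.
have [C1 energy] : exists C1, forall s, I s ->
    k_ 0 s * k_ 2 s + k_ 1 s ^+ 2 / 2 - e / 2 * k_ 0 s ^+ 4 = C1.
  pose f : R -> R :=
    k_ 0 * k_ 2 + 2^-1 *: (k_ 1 ^+ 2) - (e / 2) *: (k_ 0 ^+ 4).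
  exists (f s0) => s Is.
  transitivity (f s); first by rewrite /f !fctE /GRing.scale /=; ring.
  apply: (derive0_cst_on itvI _ _ _ Is Is0) => r Ir.
  have d0 := dk 0 r Ir; have d1 := dk 1 r Ir; have d2 := dk 2 r Ir.
  apply: (is_derive_eq (is_deriveB (is_deriveD (is_deriveM d0 d2)
    (is_deriveZ 2^-1 (is_deriveX 2 d1))) (is_deriveZ (e / 2)
    (is_deriveX 4 d0)))).
  (* The derivative of the energy is exactly the tangential expression. *)
  rewrite -[RHS](tangential r Ir) /GRing.scale /=.
  by field.
have [C2 quintic] : exists C2, forall s, I s ->
    k_ 0 s * k_ 1 s ^+ 2 - e / 5 * k_ 0 s ^+ 5 - 2 * C1 * k_ 0 s = C2.
  pose f : R -> R :=
    k_ 0 * k_ 1 ^+ 2 - (e / 5) *: (k_ 0 ^+ 5) - (2 * C1) *: k_ 0.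
  exists (f s0) => s Is.
  transitivity (f s); first by rewrite /f !fctE /GRing.scale /=; ring.
  apply: (derive0_cst_on itvI _ _ _ Is Is0) => r Ir.
  have d0 := dk 0 r Ir; have d1 := dk 1 r Ir.
  apply: (is_derive_eq (is_deriveB (is_deriveB
    (is_deriveM d0 (is_deriveX 2 d1)) (is_deriveZ (e / 5) (is_deriveX 5 d0)))
    (is_deriveZ (2 * C1) d0))).
  (* The derivative is [2 k_1] times the difference between the energy and [C1]. *)
  rewrite -(energy r Ir) !fctE /GRing.scale /=.
  by field.
(* The derivative of the tangential equation serves to eliminate [k_4] from the normal one. *)
have tangential' s : I s -> k_ 0 s * k_ 4 s + 3 * k_ 1 s * k_ 3 s + 2 * k_ 2 s ^+ 2
    - 6 * e * k_ 0 s ^+ 2 * k_ 1 s ^+ 2 - 2 * e * k_ 0 s ^+ 3 * k_ 2 s = 0.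
  move=> Is.
  pose f : R -> R :=
    k_ 0 * k_ 3 + 2 *: (k_ 1 * k_ 2) - (2 * e) *: (k_ 0 ^+ 3 * k_ 1).
  have df0 : derive1 f s = derive1 (cst 0 : R -> R) s.
    apply: (derive1_eq_on oI) => // r Ir; rewrite -[RHS](tangential r Ir).
    by rewrite /f !fctE /GRing.scale /=; ring.
  have d0 := dk 0 s Is; have d1 := dk 1 s Is; have d2 := dk 2 s Is.
  have d3 := dk 3 s Is.
  have := is_deriveB
    (is_deriveD (is_deriveM d0 d3) (is_deriveZ 2 (is_deriveM d1 d2)))
    (is_deriveZ (2 * e) (is_deriveM (is_deriveX 3 d0) d1)).
  rewrite derive1_cst derive1E in df0.
  move=> -[_]; rewrite -/f df0 !fctE /GRing.scale /= => h.
  by rewrite [RHS]h; ring.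
(* Coefficients, in increasing degree, of the elimination carried out below, simplified with
   [e ^+ 2 = 1]. The leading one involves no parameter, so [p] never vanishes identically. *)
pose p : {poly R} := Poly [:: - 7 / 2 * C2 ^+ 2; - 6 * C1 * C2; 0; - a * C2 / 2;
  0; - 42 / 5 * e * C2; - 126 / 5 * e * C1; 0; 2 / 5 * e * a - b; 0; - 126 / 25].
have p0 : p != 0.
  apply/eqP => /(congr1 (fun q : {poly R} => q`_10)).
  by rewrite coef_Poly coef0 /=; lra.
have rootp s : I s -> root p (k_ 0 s).
  move=> Is.
  have Y : k_ 0 s * k_ 1 s ^+ 2 = e / 5 * k_ 0 s ^+ 5 + 2 * C1 * k_ 0 s + C2.
    by rewrite -(quintic s Is); ring.
  (* In the energy multiplied by [k_0], inserting [Y] cancels [C1]. *)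
  have Z : k_ 0 s ^+ 2 * k_ 2 s = 2 * e / 5 * k_ 0 s ^+ 5 - C2 / 2.
    by rewrite -(quintic s Is) -(energy s Is); field.
  rewrite /root horner_Poly /=.
  have := normal s Is; have := tangential' s Is; have := tangential s Is.
  set x := k_ 0 s in Y Z *.
  set A := (X in X = 0 -> _) => A0; set A' := (X in X = 0 -> _) => A'0.
  set B := (X in X = 0 -> _) => B0.
  (* Here [A'] removes [k_4] and [A] removes the [k_3] that [A'] brings in. The powers of [x] leave
     a polynomial in [x], [x * k_1 ^+ 2] and [x ^+ 2 * k_2], ready for [Y] and [Z]. *)
  have : x ^+ 5 * B - x ^+ 4 * A' + 3 * x ^+ 3 * k_ 1 s * A = 0.
    by rewrite A0 A'0 B0 !mulr0 subr0 addr0.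
  have -> : x ^+ 5 * B - x ^+ 4 * A' + 3 * x ^+ 3 * k_ 1 s * A =
    6 * (x * k_ 1 s ^+ 2) * (x ^+ 2 * k_ 2 s) - 2 * (x ^+ 2 * k_ 2 s) ^+ 2
    - 8 * e * x ^+ 5 * (x ^+ 2 * k_ 2 s) - 15 * e * x ^+ 5 * (x * k_ 1 s ^+ 2)
    + x ^+ 10 + a * x ^+ 3 * (x ^+ 2 * k_ 2 s) - b * x ^+ 8.
    by rewrite /A /A' /B; ring.
  rewrite Y Z => P0; apply/eqP; rewrite -[RHS]P0.
  by case: he => ->; field.
have dk0 s : I s -> derivable (k_ 0) s 1 by move=> /(dk 0)[].
have kcst s : I s -> k_ 0 s = k_ 0 s0.
  by move=> Is; exact: (root_cst_on itvI dk0 p0 rootp _ _ Is Is0).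
have kS j s : I s -> k_ j.+1 s = 0.
  have d1 i r : I r -> derive1 (k_ i) r = k_ i.+1 r.
    by move=> Ir; rewrite derive1E; case: (dk i r Ir).
  elim: j s => [|j IHj] s Is; rewrite -d1//.
    by rewrite (derive1_eq_on oI (f2 := cst (k_ 0 s0))) ?derive1_cst.
  by rewrite (derive1_eq_on oI (f2 := cst 0)) ?derive1_cst.
have := normal s0 Is0; rewrite !kS// => B0.
apply: (mulfI (expf_neq0 3 (k0 s0 Is0))).
apply/eqP; rewrite -subr_eq0 -[X in _ == X]B0; apply/eqP; ring.
Qed.

End ScalarODE.

(** * Entrywise differentiation of vector-valued curves *)

Lemma derive1_mx {R : realType} {m n : nat} {M : R -> 'M[R]_(m, n)} {s : R} :
  derivable M s 1 -> derive1 M s = \matrix_(i, j) 'D_1 (fun r => M r i j) s.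
Proof. by move=> DM; rewrite derive1E derive_mx. Qed.

Lemma is_derive_scale {R : realType} {n : nat} {f : R -> R} {df s : R}
    {V : R -> 'rV[R]_n} :
  is_derive s (1 : R) f df -> derivable V s 1 ->
  is_derive s (1 : R) (fun r => f r *: V r) (df *: V s + f s *: derive1 V s).
Proof.
move=> Df DV.
have DVi i j : derivable (fun r => V r i j) s 1 by exact: (derivable_mxP V s 1).1.
have Dij i j : is_derive s (1 : R) (fun r => (f r *: V r) i j)
    (df * V s i j + f s * 'D_1 (fun r => V r i j) s).
  rewrite (_ : (fun r => _) = f * (fun r => V r i j)); last first.
    by apply/funext => r; rewrite mxE.
  apply: (is_derive_eq (is_deriveM Df (derivableP (DVi i j)))).
  by rewrite addrC /GRing.scale /= [V s i j * _]mulrC.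
have DfV : derivable (fun r => f r *: V r) s 1.
  by apply/derivable_mxP => i j; case: (Dij i j).
apply: DeriveDef => //; rewrite derive_mx// (derive1_mx DV); apply/matrixP => i j.
by rewrite [LHS]mxE derive_val !mxE.
Qed.

(** * Iterated covariant derivatives and tau_3 in the Frenet frame *)

Section FrenetFrame.
Context {R : realType} {m t : nat} {c : R}.
Local Notation E := 'rV[R]_(ambient_dim m c).
Implicit Types (p v w : E) (g V W N : R -> E) (I : set R).

Lemma tangent_projD p v w :
  tangent_proj t p (v + w) = tangent_proj t p v + tangent_proj t p w.
Proof.
rewrite /tangent_proj; case: ifP => // _.
by rewrite metricDl mulrDl scalerDl opprD addrACA.
Qed.

Lemma tangent_projZ (a : R) p v : tangent_proj t p (a *: v) = a *: tangent_proj t p v.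
Proof.
rewrite /tangent_proj; case: ifP => // _.
by rewrite metricZl scalerBr scalerA mulrA.
Qed.

Lemma tangent_proj_id {p v} : tangent_space t p v -> tangent_proj t p v = v.
Proof.
rewrite /tangent_proj; case: ifP => // /eqP c0 [//|->].
by rewrite mul0r scale0r subr0.
Qed.

Lemma metric0l v : metric t 0 v = 0.
Proof. by rewrite -(scale0r v) metricZl mul0r. Qed.

Lemma tangent_spaceZ (a : R) p v : tangent_space t p v -> tangent_space t p (a *: v).
Proof. by case=> [|h]; [left|right; rewrite metricZl h mulr0]. Qed.

Lemma metric_comb (x y : R) v w u :
  metric t (x *: v + y *: w) u = x * metric t v u + y * metric t w u.
Proof. by rewrite metricDl !metricZl. Qed.

Context {I} {g N} {e1 e2 : R} {k_ : nat -> R -> R}.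
Context (k_derive :
  forall j s, I s -> is_derive s (1 : R) (k_ j) (k_ j.+1 s)).
Context (frenet : frenet2_curve t I g e1 e2 N (k_ 0)).
Local Notation T := (velocity g).

Lemma frenet_open : open I. Proof. by case: frenet => -[[]]. Qed.

(* [covD g N] is a nonzero multiple of [velocity g] and lies in the range of the
   tangential projection. *)
Lemma velocity_tangent {s} : I s -> tangent_space t (g s) (T s).
Proof.
case: frenet => -[_ _ gM e1S _] _ _ _ F Is; have [k0 _ _ _ DN] := F s Is.
have e1k0 : - (e1 * k_ 0 s) != 0.
  rewrite oppr_eq0 mulf_neq0 ?(gt_eqF k0)//.
  by case: e1S => ->; rewrite ?oppr_eq0 oner_eq0.
rewrite -[T s](scalerK e1k0) -DN; apply: tangent_spaceZ.
by apply: tangent_projP; exact: gM.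
Qed.

(** Leibniz rule and Frenet equations, the projection fixing [T] and [N] since both are tangent.
    Covariant differentiation thus becomes an operation on the coefficient pair [(a, b)]. *)
Lemma covD_frame {a b : R -> R} {da db s : R} : I s ->
  is_derive s (1 : R) a da -> is_derive s (1 : R) b db ->
  covD t g (fun r => a r *: T r + b r *: N r) s =
  (da - e1 * k_ 0 s * b s) *: T s + (db + e2 * k_ 0 s * a s) *: N s.
Proof.
move=> Is Da Db; case: frenet => -[_ gS _ _ _] [NS NT] _ _ F.
have [_ _ _ DT DN] := F s Is.
have dT : derivable T s 1 by exact: (gS 1).
have dN : derivable N s 1 by exact: (NS 0).
have [_ D] := is_deriveD (is_derive_scale Da dT) (is_derive_scale Db dN).
rewrite /covD derive1E [X in tangent_proj _ _ X]D.
rewrite tangent_projD !(tangent_projD, tangent_projZ).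
rewrite (tangent_proj_id (velocity_tangent Is)) (tangent_proj_id (NT s Is)).
rewrite -/(covD t g T s) -/(covD t g N s) DT DN.
by apply/rowP => i; rewrite !mxE; ring.
Qed.

Lemma covDn_velocityS_frame {j} {a b : R -> R} {da db s : R} :
  (forall r, I r -> covDn_velocity t j g r = a r *: T r + b r *: N r) -> I s ->
  is_derive s (1 : R) a da -> is_derive s (1 : R) b db ->
  covDn_velocity t j.+1 g s =
  (da - e1 * k_ 0 s * b s) *: T s + (db + e2 * k_ 0 s * a s) *: N s.
Proof.
move=> Tj Is Da Db; rewrite -(covD_frame Is Da Db).
by congr tangent_proj; exact: (derive1_eq_on frenet_open Tj s Is).
Qed.

Lemma frenet_signs : is_sign e1 /\ is_sign e2.
Proof. by case: frenet => -[]. Qed.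

(** Start of the recursion. The null [T] term is kept, and the coefficients are combinations of
    functions, to fit [covDn_velocityS_frame] and the derivation rules. *)
Lemma covDn_velocity1_frame s : I s ->
  covDn_velocity t 1 g s = 0 *: T s + (e2 *: k_ 0) s *: N s.
Proof.
case: frenet => _ _ _ _ F Is; rewrite scale0r add0r.
by have [_ _ _ + _] := F s Is.
Qed.

Lemma covDn_velocity2_frame s : I s ->
  covDn_velocity t 2 g s =
  (- (e1 * e2) *: k_ 0 ^+ 2) s *: T s + (e2 *: k_ 1) s *: N s.
Proof.
move=> Is; have d0 := k_derive 0 s Is.
rewrite (covDn_velocityS_frame covDn_velocity1_frame Is (is_derive_cst _ _ _)
  (is_deriveZ _ d0)).
rewrite !fctE /GRing.scale /=; congr (_ *: _ + _ *: _); ring.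
Qed.

Lemma covDn_velocity3_frame s : I s ->
  covDn_velocity t 3 g s =
  (- (3 * e1 * e2) *: (k_ 0 * k_ 1)) s *: T s
  + (e2 *: k_ 2 - e1 *: k_ 0 ^+ 3) s *: N s.
Proof.
move=> Is; have d0 := k_derive 0 s Is; have d1 := k_derive 1 s Is.
rewrite (covDn_velocityS_frame covDn_velocity2_frame Is
  (is_deriveZ _ (is_deriveX 2 d0)) (is_deriveZ _ d1)).
rewrite !fctE /GRing.scale /=; congr (_ *: _ + _ *: _); first by ring.
(* Splitting the signs supplies [e2 ^+ 2 = 1]. *)
by case: frenet_signs => -[->|->] [->|->]; ring.
Qed.

Lemma covDn_velocity4_frame s : I s ->
  covDn_velocity t 4 g s =
  (k_ 0 ^+ 4 - (e1 * e2) *: (3 *: k_ 1 ^+ 2 + 4 *: (k_ 0 * k_ 2))) s *: T s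
  + (e2 *: k_ 3 - (6 * e1) *: (k_ 0 ^+ 2 * k_ 1)) s *: N s.
Proof.
move=> Is; have d0 := k_derive 0 s Is; have d1 := k_derive 1 s Is.
have d2 := k_derive 2 s Is.
rewrite (covDn_velocityS_frame covDn_velocity3_frame Is
  (is_deriveZ _ (is_deriveM d0 d1))
  (is_deriveB (is_deriveZ _ d2) (is_deriveZ _ (is_deriveX 3 d0)))).
rewrite !fctE /GRing.scale /=; congr (_ *: _ + _ *: _).
  by case: frenet_signs => -[->|->] [->|->]; ring.
by case: frenet_signs => -[->|->] [->|->]; ring.
Qed.

Lemma covDn_velocity5_frame s : I s ->
  covDn_velocity t 5 g s =
  (10 * k_ 0 s ^+ 3 * k_ 1 s
   - 5 * e1 * e2 * (k_ 0 s * k_ 3 s + 2 * k_ 1 s * k_ 2 s)) *: T s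
  + (e2 * (k_ 4 s + k_ 0 s ^+ 5)
     - 15 * e1 * k_ 0 s * k_ 1 s ^+ 2 - 10 * e1 * k_ 0 s ^+ 2 * k_ 2 s) *: N s.
Proof.
move=> Is; have d0 := k_derive 0 s Is; have d1 := k_derive 1 s Is.
have d2 := k_derive 2 s Is; have d3 := k_derive 3 s Is.
rewrite (covDn_velocityS_frame covDn_velocity4_frame Is
  (is_deriveB (is_deriveX 4 d0) (is_deriveZ _
     (is_deriveD (is_deriveZ 3 (is_deriveX 2 d1))
        (is_deriveZ 4 (is_deriveM d0 d2)))))
  (is_deriveB (is_deriveZ _ d3) (is_deriveZ _ (is_deriveM (is_deriveX 2 d0) d1)))).
rewrite !fctE /GRing.scale /=; congr (_ *: _ + _ *: _).
  by case: frenet_signs => -[->|->] [->|->]; ring.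
by case: frenet_signs => -[->|->] [->|->]; ring.
Qed.

(** Pair with [T] and with [N]: they are orthogonal and nonnull, which suffices although the metric
    is indefinite. *)
Lemma frame_free (x y : R) {s} : I s -> x *: T s + y *: N s = 0 -> x = 0 /\ y = 0.
Proof.
case: frenet => -[_ _ _ e1S TT] _ e2S _ F Is xy0; have [_ NN TN _ _] := F s Is.
have := congr1 (fun v => metric t v (T s)) xy0.
have := congr1 (fun v => metric t v (N s)) xy0.
rewrite /= !metric0l !metric_comb [metric t (N s) (T s)]metricC TN NN TT// !mulr0.
rewrite add0r addr0.
by case: e1S e2S => -> [] ->; rewrite ?mulrN !mulr1 => /eqP + /eqP;
  rewrite ?oppr_eq0 => /eqP -> /eqP ->.
Qed.

(** The curvature terms are purely normal: the first keeps [c e1] times the normal part of the third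
    derivative, and each of the two contributes [- c k_0 ^+ 3]. The factor [e2] is pulled out to
    expose the normal equation of [curvature_ode_cst]. *)
Lemma tau3_frame s : I s ->
  tau3 t g s =
  (10 * k_ 0 s ^+ 3 * k_ 1 s
   - 5 * e1 * e2 * (k_ 0 s * k_ 3 s + 2 * k_ 1 s * k_ 2 s)) *: T s
  + (e2 * (k_ 4 s - 15 * (e1 * e2) * k_ 0 s * k_ 1 s ^+ 2
       - 10 * (e1 * e2) * k_ 0 s ^+ 2 * k_ 2 s + k_ 0 s ^+ 5
       + (c * e1) * k_ 2 s - (2 * e2 * c) * k_ 0 s ^+ 3)) *: N s.
Proof.
move=> Is; case: frenet => -[_ _ _ _ TT] _ _ _ F; have [_ NN TN _ _] := F s Is.
rewrite /tau3 covDn_velocity5_frame// covDn_velocity3_frame//.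
rewrite covDn_velocity2_frame// covDn_velocity1_frame// /curvature_tensor.
rewrite -[covDn_velocity t 0 g s]/(T s) !metric_comb.
rewrite [metric t (N s) (T s)]metricC TN TT// !fctE.
have scaleE (x : R) (y : R^o) : x *: y = x * y by [].
apply/rowP => i; rewrite !mxE !scaleE.
by case: frenet_signs => -[->|->] [->|->]; ring.
Qed.

Lemma triharmonic_curvature : triharmonic t I g ->
  forall s, I s -> k_ 0 s ^+ 2 = 2 * e2 * c.
Proof.
case: frenet => -[[oI itvI _] _ _ _ _] _ _ _ F tau0.
have k0 s : I s -> k_ 0 s != 0 by move=> /F[/lt0r_neq0].
have [e1S e2S] := frenet_signs.
have eS : is_sign (e1 * e2).
  by case: e1S e2S => -> [] ->; rewrite ?mulrNN ?mulr1 ?mul1r;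
     [left|right|right|left].
have tau_eqs s (Is : I s) :=
  frame_free _ _ Is (etrans (esym (tau3_frame s Is)) (tau0 s Is)).
apply: (curvature_ode_cst (a := c * e1) oI itvI k_derive k0 eS) => s Is.
  (* The [T] coefficient is [- 5 e1 e2] times the tangential equation. *)
  by have [+ _] := tau_eqs s Is; case: e1S e2S => -> [] ->; lra.
have [_ /eqP] := tau_eqs s Is; rewrite mulf_eq0 => /orP[|/eqP//].
by case: e2S => ->; rewrite ?oppr_eq0 oner_eq0.
Qed.

End FrenetFrame.

Theorem corollary1p9 (R : realType) (m t : nat) (c : R)
    (hm : (2 <= m)%N) (ht : (1 <= t <= m - 1)%N)
    (I : set R) (g : R -> 'rV[R]_(ambient_dim m c)) (e1 e2 : R)
    (N : R -> 'rV[R]_(ambient_dim m c)) (k : R -> R)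
    (hg : frenet2_curve t I g e1 e2 N k)
    (hp : proper_triharmonic t I g) :
  0 < e2 * c /\ forall s : R, I s -> k s = Num.sqrt (2 * e2 * c).
Proof.
have [[[oI _ [s0 Is0]] _ _ _ _] _ _ kS F] := hg.
have kpos s : I s -> 0 < k s by move=> /F[].
have k2 : forall s, I s -> k s ^+ 2 = 2 * e2 * c.
  exact: (triharmonic_curvature (k_ := fun j => derive1n j k)
    (fun j s => is_derive_derive1n j kS) hg hp.1).
split=> [|s Is]; last by rewrite -(k2 s Is) sqrtr_sqr gtr0_norm ?kpos.
by have := exprn_gt0 2 (kpos s0 Is0); rewrite k2//; lra.
Qed.
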